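(* Let $K\in\{0,1,2,3\}$ and fix $\Delta x,\Delta y>0$. Let $\mathcal E=\mathcal E(\mathbf k)\in\mathbb C^{3(K+1)^2\times 3(K+1)^2}$ be the evolution matrix of the Discontinuous Galerkin method of degree $K$ for two-dimensional linear acoustics with the ''Low Mach'' flux, i.e. with $$D_x=\begin{pmatrix}0&0&1\\0&0&0\\-1&0&2\end{pmatrix},\qquad D_y=\begin{pmatrix}0&0&0\\0&0&1\\0&-1&2\end{pmatrix}.$$ Then $$\min_{\mathbf k\in\mathbb R^2}\dim\ker\mathcal E(\mathbf k)=(K+1)^2 .$$
   Context: Linear acoustics in 2D with variables $q=(u,v,p)$: $\partial_t q+J_x\partial_x q+J_y\partial_y q=0$ with $$J_x=\begin{pmatrix}0&0&1\\0&0&0\\1&0&0\end{pmatrix},\qquad J_y=\begin{pmatrix}0&0&0\\0&0&1\\0&1&0\end{pmatrix}.$$ Basis: $b_0,\dots,b_K$ is the $L^2(-\frac12,\frac12)$-orthonormal polynomial basis with $\deg b_k=k$ ($b_0=1$, $b_1=2\sqrt3x$, $b_2=\frac{\sqrt5}{2}(12x^2-1)$, $b_3=\sqrt7x(20x^2-3)$), so the mass matrix is $M^k_\alpha=\delta_{k\alpha}$. Put $G^k_\alpha=\int_{-1/2}^{1/2}b_k'(\xi)b_\alpha(\xi)\,d\xi$. Numerical fluxes: $\hat f^x(q_L,q_R)=J_x\frac{q_L+q_R}{2}-D_x\frac{q_R-q_L}{2}$, and analogously $\hat f^y$ with $J_y,D_y$; $D_x,D_y$ are $3\times3$ matrices.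 Evolution matrix: for $\mathbf k=(k_x,k_y)$ let $t_x=e^{\mathrm ik_x\Delta x}$, $t_y=e^{\mathrm ik_y\Delta y}$. Inserting $q_{ij}^{(\alpha\beta)}(t)=\hat q^{(\alpha\beta)}(t)t_x^it_y^j$ (with $\hat q^{(\alpha\beta)}\in\mathbb C^3$) in the semi-discrete DG method of tensor-product degree $K$ on the Cartesian grid with spacings $\Delta x,\Delta y$ yields $\frac{d}{dt}\hat q^{(k\ell)}+\sum_{\alpha,\beta=0}^K\mathcal E^{k\ell}_{\alpha\beta}\hat q^{(\alpha\beta)}=0$, where the $3\times3$ blocks of $\mathcal E$ are $$\begin{aligned}\mathcal E^{k\ell}_{\alpha\beta}=&-\tfrac1{\Delta x}J_xM^\ell_\beta G^k_\alpha-\tfrac1{\Delta y}J_yM^k_\alpha G^\ell_\beta\\&+\frac{b_k(\frac12)t_x-b_k(-\frac12)}{t_x\Delta x}\left(J_x\frac{b_\alpha(\frac12)+t_xb_\alpha(-\frac12)}2-D_x\frac{t_xb_\alpha(-\frac12)-b_\alpha(\frac12)}2\right)M^\ell_\beta\\&+\frac{b_\ell(\frac12)t_y-b_\ell(-\frac12)}{t_y\Delta y}\left(J_y\frac{b_\beta(\frac12)+t_yb_\beta(-\frac12)}2-D_y\frac{t_yb_\beta(-\frac12)-b_\beta(\frac12)}2\right)M^k_\alpha .\end{aligned}$$ *)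

(* Defs.v *)
From HB Require Import structures.
From mathcomp Require Import all_boot all_order all_algebra.
From mathcomp Require Import complex mxtens.
From mathcomp Require Import all_classical all_reals all_analysis.

Set Implicit Arguments.
Unset Strict Implicit.
Unset Printing Implicit Defensive.

Import Order.TTheory GRing.Theory Num.Theory.

Local Open Scope classical_set_scope.
Local Open Scope complex_scope.
Local Open Scope ring_scope.

Definition mx3_of_rows (F : nzRingType) (rows : seq (seq F)) : 'M[F]_3 :=
  \matrix_(i < 3, j < 3) (nth [::] rows i)`_j.

Definition acousticsJx (F : nzRingType) : 'M[F]_3 :=
  mx3_of_rows [:: [:: 0; 0; 1]; [:: 0; 0; 0]; [:: 1; 0; 0]].

Definition acousticsJy (F : nzRingType) : 'M[F]_3 :=
  mx3_of_rows [:: [:: 0; 0; 0]; [:: 0; 0; 1]; [:: 0; 1; 0]].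

Definition lowMachDx (F : nzRingType) : 'M[F]_3 :=
  mx3_of_rows [:: [:: 0; 0; 1]; [:: 0; 0; 0]; [:: -1; 0; 2]].

Definition lowMachDy (F : nzRingType) : 'M[F]_3 :=
  mx3_of_rows [:: [:: 0; 0; 0]; [:: 0; 0; 1]; [:: 0; -1; 2]].

(* The L^2(-1/2, 1/2)-orthonormal polynomials b_0, ..., b_3; indices above 3
   are never used and get the dummy value 0. *)
Definition dg_basis (R : realType) (k : nat) : {poly R} :=
  [:: 1;
      (2 * Num.sqrt 3) *: 'X;
      (Num.sqrt 5 / 2) *: (12 *: 'X^2 - 1);
      Num.sqrt 7 *: ('X * (20 *: 'X^2 - 3%:P))]`_k.

Definition cell_integral (R : realType) (f : R -> R) : R :=
  Rintegral (@lebesgue_measure R) `[- 2^-1, 2^-1] f.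

(* massM k a and stiffG k a have the upper index k first and the lower index a
   second; the derivative in stiffG falls on the upper index. *)
Definition massM (R : realType) (k a : nat) : R :=
  cell_integral (fun x => (dg_basis R k).[x] * (dg_basis R a).[x]).

Definition stiffG (R : realType) (k a : nat) : R :=
  cell_integral (fun x => (dg_basis R k)^`().[x] * (dg_basis R a).[x]).

Definition cis (R : realType) (theta : R) : R[i] := cos theta +i* sin theta.

(* One-dimensional interface term, written once for both directions, for the
   flux J (qL + qR) / 2 - D (qR - qL) / 2:
     (b_k(1/2) t - b_k(-1/2)) / (t h)
       * (J (b_a(1/2) + t b_a(-1/2)) / 2 - D (t b_a(-1/2) - b_a(1/2)) / 2). *)
Definition flux_block (R : realType) (J D : 'M[R[i]]_3) (h : R) (t : R[i])
    (k a : nat) : 'M[R[i]]_3 :=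
  let bR m := ((dg_basis R m).[2^-1])%:C in
  let bL m := ((dg_basis R m).[- 2^-1])%:C in
  ((bR k * t - bL k) / (t * h%:C)) *:
    (((bR a + t * bL a) / 2) *: J - ((t * bL a - bR a) / 2) *: D).

Definition evolution_block (R : realType) (Dx Dy : 'M[R[i]]_3)
    (dx dy kx ky : R) (k l a b : nat) : 'M[R[i]]_3 :=
  let Jx := acousticsJx R[i] in
  let Jy := acousticsJy R[i] in
  let tx := cis (kx * dx) in
  let ty := cis (ky * dy) in
  - (dx^-1 * massM R l b * stiffG R k a)%:C *: Jx
  - (dy^-1 * massM R k a * stiffG R l b)%:C *: Jy
  + (massM R l b)%:C *: flux_block Jx Dx dx tx k a
  + (massM R k a)%:C *: flux_block Jy Dy dy ty l b.

(* Rows are indexed by ((k, l), r) and columns by ((a, b), s), with r, s < 3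
   the components of q = (u, v, p), flattened by mxtens_index. *)
Definition evolution_matrix (R : realType) (K : nat) (Dx Dy : 'M[R[i]]_3)
    (dx dy kx ky : R) : 'M[R[i]]_(K.+1 * K.+1 * 3) :=
  \matrix_(I, J)
    let kl := mxtens_unindex (mxtens_unindex I).1 in
    let ab := mxtens_unindex (mxtens_unindex J).1 in
    evolution_block Dx Dy dx dy kx ky kl.1 kl.2 ab.1 ab.2
      (mxtens_unindex I).2 (mxtens_unindex J).2.

(* Dimension of {v | A *m v = 0}; kermx itself is the left kernel, whence the
   transpose. *)
Definition dim_ker (F : fieldType) (n : nat) (A : 'M[F]_n) : nat :=
  \rank (kermx A^T).

(* Main.v *)
From HB Require Import structures.
Require Import Defs.
From mathcomp Require Import all_boot all_order all_algebra.
From mathcomp Require Import complex mxtens.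
From mathcomp Require Import all_classical all_reals all_analysis.
From mathcomp Require Import zify ring lra.
Import Order.TTheory GRing.Theory Num.Theory.
Local Open Scope complex_scope.
Local Open Scope ring_scope.

(* With the Low Mach flux the equations for u and v involve p only, so the
   nonzero entries of E lie in the (K+1)^2 rows or the (K+1)^2 columns of p:
   the rank is at most 2 (K+1)^2. The flux of p in the u-equation is the left
   trace of p and that of u in the p-equation is the right trace of u; hence the
   (u, p) and (p, u) blocks are Kronecker products of a one-dimensional one-sided
   DG transport matrix with the mass matrix. For k_x = pi / dx, that is t_x = -1,
   these are real and invertible, so the rank is exactly 2 (K+1)^2. Invertibility
   uses only that deg b_k = k: the matrices are Gram matrices of nondegenerate
   bilinear forms on polynomials, whose integrals need not be evaluated. *)

Set Implicit Arguments.
Unset Strict Implicit.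

(** * Integrals of polynomials over the reference cell *)

Lemma horner_cell_integrable (R : realType) (p : {poly R}) :
  (@lebesgue_measure R).-integrable `[- 2^-1, 2^-1]%classic (EFin \o horner p).
Proof.
apply: continuous_compact_integrable; first exact: segment_compact.
apply: continuous_subspaceT; exact: continuous_horner.
Qed.

Lemma cell_integral_horner_linear (R : realType) (c : R) (p q : {poly R}) :
  cell_integral (horner (c *: p + q)) =
  c * cell_integral (horner p) + cell_integral (horner q).
Proof.
rewrite /cell_integral -RintegralZl//; last exact: horner_cell_integrable.
rewrite -RintegralD//; last 2 first.
- have -> : (fun x => c * p.[x]) = horner (c *: p).
    by apply/funext => x; rewrite hornerZ.
  exact: horner_cell_integrable.
- exact: horner_cell_integrable.
apply: eq_Rintegral => x _; transitivity (c *: p + q).[x] => //.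
by rewrite hornerD hornerZ.
Qed.

Lemma finite_set_roots (R : idomainType) (p : {poly R}) :
  p != 0 -> finite_set [set x | root p x]%classic.
Proof.
move=> p_neq0; apply: contrapT => /(@infinite_set_fset _ _ (size p))[B BP].
rewrite leqNgt max_poly_roots//; last exact: finmap.fset_uniq.
by apply/allP => x xB; exact: BP.
Qed.

(** A nonnegative function with integral zero vanishes almost everywhere. If [p] were nonzero, its
    roots would be finite in number, so the cell would lie in the union of two null sets, although
    its measure is 1. *)
Lemma cell_integral_horner_eq0 (R : realType) (p : {poly R}) :
  (forall x, - 2^-1 <= x <= 2^-1 -> 0 <= p.[x]) ->
  cell_integral (horner p) = 0 -> p = 0.
Proof.
move=> p_ge0 Ip0; apply/eqP/negPn/negP => p_neq0.
have mu0 : (\int[@lebesgue_measure R]_(x in `[(- 2^-1)%R, (2^-1)%R])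
     `|(p.[x])%:E| = 0)%E.
  transitivity (\int[@lebesgue_measure R]_(x in `[(- 2^-1)%R, (2^-1)%R])
     (p.[x])%:E)%E.
    apply: eq_integral => x; rewrite inE/= in_itv/= => /p_ge0 px.
    by rewrite ger0_norm.
  rewrite -[LHS]fineK; last first.
    by apply: integrable_fin_num => //; exact: horner_cell_integrable.
  by rewrite -/(Rintegral _ _ _) -/(cell_integral (horner p)) Ip0.
have mp := measurable_int _ (horner_cell_integrable p).
have [N [mN N0 sN]] := (ae_eq_integral_abs (@lebesgue_measure R)
  (measurable_itv `[- 2^-1, 2^-1]) mp).1 mu0.
have mZ : measurable [set x | root p x]%classic.
  exact: countable_measurable (finite_set_countable (finite_set_roots p_neq0)).
have := lebesgue_measure_itv `[- (2^-1 : R), 2^-1]; rewrite /= lte_fin.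
rewrite ifT; last by lra.
move/eqP; apply/negP; rewrite -EFinB.
have -> : 2^-1 - - 2^-1 = 1 :> R by lra.
suff -> : @lebesgue_measure R `[- 2^-1, 2^-1]%classic = 0
  by rewrite eqe eq_sym oner_eq0.
apply: (subset_measure0 (B := N `|` [set x | root p x])%classic) => //.
- exact: measurableU.
- move=> x xI; have [px|px] := boolP (root p x); [by right|left].
  apply: sN => /= /(_ xI) [px0]; by rewrite /root px0 eqxx in px.
apply/eqP; rewrite -measure_le0; apply: le_trans (measureU2 _ _ _) _ => //.
have Z0 := countable_lebesgue_measure0
  (finite_set_countable (finite_set_roots p_neq0)).
by rewrite [X in (X + _)%E]N0 [X in (_ + X)%E]Z0 adde0.
Qed.

(** * Gram matrices of bilinear forms on polynomials *)

Definition basis_mx (F : nzRingType) (n : nat) (b : nat -> {poly F}) : 'M[F]_n :=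
  \matrix_(i < n) poly_rV (b i).

(** The matrix is lower triangular, with the leading coefficients of the [b i] on the diagonal. *)
Lemma basis_mx_unit (F : fieldType) (n : nat) (b : nat -> {poly F}) :
  (forall i, (i < n)%N -> size (b i) = i.+1) -> basis_mx n b \in unitmx.
Proof.
move=> size_b; rewrite unitmxE det_trig; last first.
  by apply/is_trig_mxP => i j ij; rewrite !mxE nth_default// size_b.
rewrite unitfE; apply/prodf_neq0 => i _; rewrite !mxE.
have -> : (b i)`_i = lead_coef (b i) by rewrite lead_coefE size_b.
by rewrite lead_coef_eq0 -size_poly_eq0 size_b.
Qed.

Lemma rVpoly_basis_mx (F : fieldType) (n : nat) (b : nat -> {poly F}) :
  (forall i, (i < n)%N -> size (b i) = i.+1) ->
  forall c : 'rV[F]_n,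
    rVpoly (c *m basis_mx n b) = \sum_(i < n) c 0 i *: b i.
Proof.
move=> size_b c; rewrite mulmx_sum_row linear_sum; apply: eq_bigr => i _.
by rewrite linearZ/= rowK poly_rV_K// size_b.
Qed.

(** Linearity is a hypothesis on a bare function, so that either argument of a bilinear form can be
    treated. *)
Lemma linear_fun_sum (F : pzRingType) (V : lmodType F) (f : V -> F) :
  (forall c p q, f (c *: p + q) = c * f p + f q) ->
  forall (I : finType) (c : I -> F) (p : I -> V),
    f (\sum_i c i *: p i) = \sum_i c i * f (p i).
Proof.
move=> f_lin I c p.
have f0 : f 0 = 0.
  by have := f_lin (-1) 0 0; rewrite scaler0 addr0 mulN1r addNr.
elim/big_rec2 : _ => [//|i x y _ <-]; exact: f_lin.
Qed.

(** A left kernel vector [w] holds the coordinates of a polynomial orthogonal to every [b j], hence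
    to all polynomials of size at most [n]. Nondegeneracy makes this polynomial zero, and [w]
    vanishes because the [b i] form a basis. *)
Lemma gram_unitmx (F : fieldType) (n : nat) (b : nat -> {poly F})
    (phi : {poly F} -> {poly F} -> F) :
  (forall i, (i < n)%N -> size (b i) = i.+1) ->
  (forall q c p p', phi (c *: p + p') q = c * phi p q + phi p' q) ->
  (forall p c q q', phi p (c *: q + q') = c * phi p q + phi p q') ->
  (forall p : {poly F}, (size p <= n)%N ->
     (forall q : {poly F}, (size q <= n)%N -> phi p q = 0) -> p = 0) ->
  \matrix_(i < n, j < n) phi (b i) (b j) \in unitmx.
Proof.
move=> size_b phi_linl phi_linr phi_nondeg.
have C_unit := basis_mx_unit size_b.
rewrite -row_free_unit -kermx_eq0; apply/rowV0P => w /sub_kermxP w0.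
have C_free : row_free (basis_mx n b) by rewrite row_free_unit.
apply/eqP; rewrite -(mulmx_free_eq0 _ C_free).
apply/eqP; rewrite -[LHS]rVpolyK; rewrite [rVpoly _]phi_nondeg ?linear0//.
  exact: size_poly.
move=> q size_q; rewrite -[q](poly_rV_K size_q).
rewrite -[poly_rV q](mulmxKV C_unit) !rVpoly_basis_mx//.
rewrite (linear_fun_sum (phi_linr _)) big1// => j _.
rewrite (linear_fun_sum (f := phi^~ (b j)))//.
have /rowP/(_ j) := w0; rewrite !mxE => wj.
apply/eqP; rewrite mulf_eq0; apply/orP; right; apply/eqP; rewrite -[RHS]wj.
by apply: eq_bigr => i _; rewrite mxE.
Qed.

(** * Rank bounds from submatrices and from the support *)

Lemma mxrank_rowsub (F : fieldType) (m n m' : nat) (f : 'I_m' -> 'I_m)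
    (A : 'M[F]_(m, n)) : (\rank (rowsub f A) <= \rank A)%N.
Proof. by rewrite rowsubE mxrankM_maxr. Qed.

Lemma mxrank_mxsub (F : fieldType) (m n m' n' : nat) (f : 'I_m' -> 'I_m)
    (g : 'I_n' -> 'I_n) (A : 'M[F]_(m, n)) :
  (\rank (mxsub f g A) <= \rank A)%N.
Proof.
rewrite mxsubrc; apply: leq_trans (mxrank_rowsub _ _) _.
by rewrite -mxrank_tr trmx_mxsub -[leqRHS]mxrank_tr mxrank_rowsub.
Qed.

(** The matrix splits into a part carried by the rows in the image of [f], of rank at most [p], and
    a part carried by the columns in the image of [g], of rank at most [q]. *)
Lemma mxrank_support (F : fieldType) (m n p q : nat) (f : 'I_p -> 'I_m)
    (g : 'I_q -> 'I_n) (A : 'M[F]_(m, n)) :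
  (forall i j, i \notin codom f -> j \notin codom g -> A i j = 0) ->
  (\rank A <= p + q)%N.
Proof.
move=> A0.
pose Ar : 'M[F]_(m, n) := \matrix_(i, j) (if i \in codom f then A i j else 0).
pose Ac : 'M[F]_(m, n) :=
  \matrix_(i, j) (if i \in codom f then 0 else if j \in codom g then A i j else 0).
have -> : A = Ar + Ac.
  apply/matrixP => i j; rewrite !mxE.
  have [|fi] := boolP (i \in codom f); first by rewrite addr0.
  by have [|gj] := boolP (j \in codom g); rewrite add0r// A0.
apply: leq_trans (mxrank_add _ _) _; apply: leq_add.
  have Ar_sub : (Ar <= rowsub f Ar)%MS.
    apply/row_subP => i; have [/codomP[k ik]|fi] := boolP (i \in codom f).
      have -> : row i Ar = row k (rowsub f Ar) by rewrite row_rowsub ik.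
      exact: row_sub.
    suff -> : row i Ar = 0 by exact: sub0mx.
    by apply/rowP => j; rewrite !mxE (negbTE fi).
  exact: leq_trans (mxrankS Ar_sub) (rank_leq_row _).
rewrite -mxrank_tr.
have Ac_sub : (Ac^T <= rowsub g Ac^T)%MS.
  apply/row_subP => j; have [/codomP[k jk]|gj] := boolP (j \in codom g).
    have -> : row j Ac^T = row k (rowsub g Ac^T) by rewrite row_rowsub jk.
    exact: row_sub.
  suff -> : row j Ac^T = 0 by exact: sub0mx.
  by apply/rowP => i; rewrite !mxE (negbTE gj) if_same.
exact: leq_trans (mxrankS Ac_sub) (rank_leq_row _).
Qed.

(** * Degrees of the basis and entries of the evolution blocks *)

Lemma size_dg_basis (R : realType) (i : nat) :
  (i <= 3)%N -> size (dg_basis R i) = i.+1.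
Proof.
have s3 : Num.sqrt 3 != 0 :> R by rewrite sqrtr_eq0 -ltNge; lra.
have s5 : Num.sqrt 5 != 0 :> R by rewrite sqrtr_eq0 -ltNge; lra.
have s7 : Num.sqrt 7 != 0 :> R by rewrite sqrtr_eq0 -ltNge; lra.
have szX c (d : R) (n : nat) : c != 0 -> (0 < n)%N ->
    size (c *: 'X^n - d%:P) = n.+1.
  move=> c0 n0; rewrite size_polyDl size_scale// size_polyXn// size_polyN.
  by rewrite (leq_ltn_trans (size_polyC_leq1 _)).
case: i => [|[|[|[|//]]]] _; rewrite /dg_basis /=.
- by rewrite size_poly1.
- by rewrite size_scale ?size_polyX// mulf_neq0// pnatr_eq0.
- by rewrite size_scale ?szX// ?mulf_neq0 ?invr_eq0 ?pnatr_eq0.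
- rewrite size_scale// mulrC size_mulX ?szX ?pnatr_eq0//.
  by rewrite -size_poly_eq0 szX ?pnatr_eq0.
Qed.

Lemma flux_blockE (R : realType) (J D : 'M[R[i]]_3) (h : R) (t : R[i])
    (k a : nat) (r s : 'I_3) :
  let bR m := ((dg_basis R m).[2^-1])%:C in
  let bL m := ((dg_basis R m).[- 2^-1])%:C in
  flux_block J D h t k a r s = (bR k * t - bL k) / (t * h%:C) *
    ((bR a + t * bL a) / 2 * J r s - (t * bL a - bR a) / 2 * D r s).
Proof. by rewrite /flux_block !mxE. Qed.

Lemma evolution_blockE (R : realType) (Dx Dy : 'M[R[i]]_3) (dx dy kx ky : R)
    (k l a b : nat) (r s : 'I_3) (jx jy fx fy : R[i]) :
  acousticsJx R[i] r s = jx -> acousticsJy R[i] r s = jy ->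
  flux_block (acousticsJx R[i]) Dx dx (cis (kx * dx)) k a r s = fx ->
  flux_block (acousticsJy R[i]) Dy dy (cis (ky * dy)) l b r s = fy ->
  evolution_block Dx Dy dx dy kx ky k l a b r s =
  - (dx^-1 * massM R l b * stiffG R k a)%:C * jx
  - (dy^-1 * massM R k a * stiffG R l b)%:C * jy
  + (massM R l b)%:C * fx + (massM R k a)%:C * fy.
Proof.
(* Generalizing the matrices and scalars keeps [mxE] from unfolding them. *)
rewrite /evolution_block; move: (acousticsJx _) (acousticsJy _) => Jx Jy.
move: (flux_block _ _ _ _ k a) (flux_block _ _ _ _ l b) => Fx Fy.
move: (massM R l b)%:C (massM R k a)%:C (_ * _)%:C (_ * _)%:C => c1 c2 c3 c4.
by move=> <- <- <- <-; rewrite !mxE.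
Qed.

Lemma flux_block_eq0 (R : realType) (J D : 'M[R[i]]_3) (h : R) (t : R[i])
    (k a : nat) (r s : 'I_3) :
  J r s = 0 -> D r s = 0 -> flux_block J D h t k a r s = 0.
Proof. by move=> J0 D0; rewrite flux_blockE J0 D0 !mulr0 subr0 mulr0. Qed.

(* The flux uses the left trace when D = J and the right trace when D = - J. *)
Lemma flux_block_left (R : realType) (J D : 'M[R[i]]_3) (h : R) (t : R[i])
    (k a : nat) (r s : 'I_3) :
  J r s = 1 -> D r s = 1 ->
  flux_block J D h t k a r s =
  (((dg_basis R k).[2^-1])%:C * t - ((dg_basis R k).[- 2^-1])%:C) / (t * h%:C) *
  ((dg_basis R a).[2^-1])%:C.
Proof.
move=> J1 D1; rewrite flux_blockE J1 D1; congr (_ * _).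
move: ((dg_basis R a).[2^-1])%:C ((dg_basis R a).[- 2^-1])%:C => x y.
by field.
Qed.

Lemma flux_block_right (R : realType) (J D : 'M[R[i]]_3) (h : R) (t : R[i])
    (k a : nat) (r s : 'I_3) :
  J r s = 1 -> D r s = -1 ->
  flux_block J D h t k a r s =
  (((dg_basis R k).[2^-1])%:C * t - ((dg_basis R k).[- 2^-1])%:C) / (t * h%:C) *
  (t * ((dg_basis R a).[- 2^-1])%:C).
Proof.
move=> J1 D1; rewrite flux_blockE J1 D1; congr (_ * _).
move: ((dg_basis R a).[2^-1])%:C ((dg_basis R a).[- 2^-1])%:C => x y.
by field.
Qed.

Lemma cis_pi_div (R : realType) (h : R) : 0 < h -> cis (pi / h * h) = -1 :> R[i].
Proof.
move=> h0; rewrite divfK ?gt_eqF// /cis cospi sinpi.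
by apply/eqP; rewrite eq_complex /= oppr0 !eqxx.
Qed.

Definition comp_u : 'I_3 := @Ordinal 3 0 isT.
Definition comp_p : 'I_3 := @Ordinal 3 2 isT.

Lemma acoustics_up (F : nzRingType) :
  [/\ acousticsJx F comp_u comp_p = 1, acousticsJy F comp_u comp_p = 0,
      lowMachDx F comp_u comp_p = 1 & lowMachDy F comp_u comp_p = 0].
Proof. by rewrite !mxE. Qed.

Lemma acoustics_pu (F : nzRingType) :
  [/\ acousticsJx F comp_p comp_u = 1, acousticsJy F comp_p comp_u = 0,
      lowMachDx F comp_p comp_u = -1 & lowMachDy F comp_p comp_u = 0].
Proof. by rewrite !mxE. Qed.

Lemma acoustics_velocity (F : nzRingType) (r s : 'I_3) :
  r != comp_p -> s != comp_p ->
  [/\ acousticsJx F r s = 0, acousticsJy F r s = 0,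
      lowMachDx F r s = 0 & lowMachDy F r s = 0].
Proof.
rewrite !mxE; case: r => [[|[|[|//]]] hr] // _;
  by case: s => [[|[|[|//]]] hs] // _.
Qed.

Lemma evolution_block_velocity (R : realType) (dx dy kx ky : R)
    (k l a b : nat) (r s : 'I_3) :
  r != comp_p -> s != comp_p ->
  evolution_block (lowMachDx R[i]) (lowMachDy R[i]) dx dy kx ky k l a b r s = 0.
Proof.
move=> rp sp; have [Jx0 Jy0 Dx0 Dy0] := acoustics_velocity R[i] rp sp.
rewrite (evolution_blockE Jx0 Jy0 (flux_block_eq0 _ _ _ _ Jx0 Dx0)
  (flux_block_eq0 _ _ _ _ Jy0 Dy0)).
by rewrite !mulr0 subrr !addr0.
Qed.

(* The factors 1 here and -1 in evolution_block_pu match the parameter c of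
   transport_form below. *)
Lemma evolution_block_up (R : realType) (dx dy ky : R) (k l a b : nat) :
  0 < dx ->
  evolution_block (lowMachDx R[i]) (lowMachDy R[i]) dx dy (pi / dx) ky k l a b
      comp_u comp_p =
  (dx^-1 * (massM R l b * (- stiffG R k a + 1 *
     ((dg_basis R k).[2^-1] + (dg_basis R k).[- 2^-1]) *
     (dg_basis R a).[2^-1])))%:C.
Proof.
move=> dx0; have [Jx Jy Dx Dy] := acoustics_up R[i].
rewrite (evolution_blockE Jx Jy (flux_block_left _ _ _ _ Jx Dx)
  (flux_block_eq0 _ _ _ _ Jy Dy)) cis_pi_div//.
have dxC : dx%:C != 0 :> R[i] by rewrite fmorph_eq0 gt_eqF.
rewrite !(rmorphM, rmorphD, rmorphN, fmorphV, rmorph1)/=.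
(* With t already equal to -1, all integrals and traces become atoms and a rational identity is left
   for [field]. *)
move: dxC; move: dx%:C dy%:C => x y xC.
move: (massM R l b)%:C (massM R k a)%:C (stiffG R k a)%:C (stiffG R l b)%:C.
move=> m1 m2 g1 g2.
move: ((dg_basis R k).[2^-1])%:C ((dg_basis R k).[- 2^-1])%:C.
move: ((dg_basis R a).[2^-1])%:C => b1 b2 b3; rewrite !mulr0.
by field.
Qed.

Lemma evolution_block_pu (R : realType) (dx dy ky : R) (k l a b : nat) :
  0 < dx ->
  evolution_block (lowMachDx R[i]) (lowMachDy R[i]) dx dy (pi / dx) ky k l a b
      comp_p comp_u =
  (dx^-1 * (massM R l b * (- stiffG R k a + -1 *
     ((dg_basis R k).[2^-1] + (dg_basis R k).[- 2^-1]) *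
     (dg_basis R a).[- 2^-1])))%:C.
Proof.
move=> dx0; have [Jx Jy Dx Dy] := acoustics_pu R[i].
rewrite (evolution_blockE Jx Jy (flux_block_right _ _ _ _ Jx Dx)
  (flux_block_eq0 _ _ _ _ Jy Dy)) cis_pi_div//.
have dxC : dx%:C != 0 :> R[i] by rewrite fmorph_eq0 gt_eqF.
rewrite !(rmorphM, rmorphD, rmorphN, fmorphV, rmorph1)/=.
move: dxC; move: dx%:C dy%:C => x y xC.
move: (massM R l b)%:C (massM R k a)%:C (stiffG R k a)%:C (stiffG R l b)%:C.
move=> m1 m2 g1 g2.
move: ((dg_basis R k).[2^-1])%:C ((dg_basis R k).[- 2^-1])%:C.
move: ((dg_basis R a).[- 2^-1])%:C => b1 b2 b3; rewrite !mulr0.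
by field.
Qed.

(** * The bilinear forms behind the mass and transport matrices *)

Definition cell_form (R : realType) (p q : {poly R}) : R :=
  cell_integral (horner (p * q)).

Lemma cell_form_linearl (R : realType) (q : {poly R}) (c : R) (p p' : {poly R}) :
  cell_form (c *: p + p') q = c * cell_form p q + cell_form p' q.
Proof.
by rewrite /cell_form mulrDl -scalerAl cell_integral_horner_linear.
Qed.

Lemma cell_form_linearr (R : realType) (p : {poly R}) (c : R) (q q' : {poly R}) :
  cell_form p (c *: q + q') = c * cell_form p q + cell_form p q'.
Proof.
by rewrite /cell_form mulrDr -scalerAr cell_integral_horner_linear.
Qed.

(** The integrand w p^2 is nonnegative on the cell, so a zero integral forces it to be the zero
    polynomial. *)
Lemma cell_form_weight_eq0 (R : realType) (w p : {poly R}) :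
  w != 0 -> (forall x, - 2^-1 <= x <= 2^-1 -> 0 <= w.[x]) ->
  cell_form p (w * p) = 0 -> p = 0.
Proof.
move=> w_neq0 w_ge0 /cell_integral_horner_eq0 wpp.
have /eqP : p * (w * p) = 0.
  apply: wpp => x /w_ge0 wx; rewrite !hornerM mulrCA mulr_ge0//.
  by rewrite -expr2 sqr_ge0.
by rewrite !mulf_eq0 (negbTE w_neq0) orbb => /eqP.
Qed.

Lemma massM_form (R : realType) (k a : nat) :
  massM R k a = cell_form (dg_basis R k) (dg_basis R a).
Proof.
by congr (cell_integral _); apply/funext => x; rewrite hornerM.
Qed.

Lemma stiffG_form (R : realType) (k a : nat) :
  stiffG R k a = cell_form (dg_basis R k)^`() (dg_basis R a).
Proof.
by congr (cell_integral _); apply/funext => x; rewrite hornerM.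
Qed.

(* At t = -1 the interface factor (b_k(1/2) t - b_k(-1/2)) / t becomes
   b_k(1/2) + b_k(-1/2), up to h. The pairs (c, x0) = (1, 1/2) and (-1, -1/2)
   are the left and right one-sided fluxes; the sign is the factor t carried by
   the value taken from the right neighbour. *)
Definition transport_form (R : realType) (c x0 : R) (p q : {poly R}) : R :=
  - cell_form p^`() q + c * (p.[2^-1] + p.[- 2^-1]) * q.[x0].

(* Testing with q = w p' kills the interface term because w vanishes at x0, so
   p' = 0; then q = 1 kills the remaining constant. *)
Lemma transport_form_nondegenerate (R : realType) (n : nat) (c x0 : R)
    (w p : {poly R}) :
  c != 0 -> w != 0 -> (size w <= 2)%N -> w.[x0] = 0 ->
  (forall x, - 2^-1 <= x <= 2^-1 -> 0 <= w.[x]) ->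
  (size p <= n)%N ->
  (forall q : {poly R}, (size q <= n)%N -> transport_form c x0 p q = 0) -> p = 0.
Proof.
move=> c_neq0 w_neq0 size_w wx0 w_ge0 size_p p_orth.
apply/eqP/negPn/negP => p_neq0.
have p'0 : p^`() = 0.
  (* Differentiation lowers the size by at least one and [w] raises it by at most one, so w p'
     remains an admissible test polynomial. *)
  have size_wp' : (size (w * p^`())%R <= n)%N.
    apply: leq_trans size_p; apply: leq_trans (size_polyMleq _ _) _.
    by move: (lt_size_deriv p_neq0) size_w; lia.
  apply: (cell_form_weight_eq0 w_neq0 w_ge0); apply/eqP; rewrite -oppr_eq0.
  have := p_orth _ size_wp'.
  by rewrite /transport_form hornerM wx0 mul0r mulr0 addr0 => ->.
have /size1_polyC p_const : (size p <= 1)%N.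
  move/eqP: p'0; rewrite -size_poly_eq0 polyorder.size_deriv.
  by case: (size p) => [|[]].
have size1 : (size (1%R : {poly R}) <= n)%N.
  by rewrite size_poly1 (leq_trans _ size_p)// lt0n size_poly_eq0.
have /eqP := p_orth _ size1.
have form01 : cell_form 0 (1 : {poly R}) = 0.
  have := cell_form_linearl (1 : {poly R}) (-1) 0 0.
  by rewrite scaler0 addr0 mulN1r addNr.
(* For constant p the form at q = 1 equals 2 c p. The plus sign between the traces comes from t =
   -1; at t = 1 their difference would annihilate constants. *)
rewrite /transport_form p'0 form01 oppr0 add0r hornerC mulr1.
rewrite p_const !hornerC mulf_eq0 (negbTE c_neq0)/=.
rewrite -mulr2n mulrn_eq0/= => /eqP p00.
by rewrite p_const p00 eqxx in p_neq0.
Qed.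

Lemma transport_form_linearl (R : realType) (d x0 : R) (q : {poly R}) (c : R)
    (p p' : {poly R}) :
  transport_form d x0 (c *: p + p') q =
  c * transport_form d x0 p q + transport_form d x0 p' q.
Proof.
rewrite /transport_form derivD derivZ cell_form_linearl !hornerD !hornerZ; ring.
Qed.

Lemma transport_form_linearr (R : realType) (d x0 : R) (p : {poly R}) (c : R)
    (q q' : {poly R}) :
  transport_form d x0 p (c *: q + q') =
  c * transport_form d x0 p q + transport_form d x0 p q'.
Proof.
rewrite /transport_form cell_form_linearr !hornerD !hornerZ; ring.
Qed.

(** * Invertibility of the one-dimensional matrices *)

Lemma dg_mass_unitmx (R : realType) (n : nat) :
  (n <= 4)%N -> \matrix_(i < n, j < n) massM R i j \in unitmx.
Proof.
move=> n4; have size_b i : (i < n)%N -> size (dg_basis R i) = i.+1.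
  by move=> i_n; rewrite size_dg_basis// -ltnS (leq_trans i_n).
rewrite (_ : matrix_of_fun _ _ =
  \matrix_(i < n, j < n) cell_form (dg_basis R i) (dg_basis R j)); last first.
  by apply/matrixP => i j; rewrite !mxE massM_form.
apply: (gram_unitmx size_b (@cell_form_linearl R) (@cell_form_linearr R)).
move=> p size_p p_orth.
(* The weight 1 gives definiteness: test with q = p. *)
apply: (@cell_form_weight_eq0 R 1); first exact: oner_neq0.
  by move=> x _; rewrite hornerC ler01.
by rewrite mul1r p_orth.
Qed.

Lemma dg_transport_unitmx (R : realType) (n : nat) (c x0 : R) (w : {poly R}) :
  (n <= 4)%N -> c != 0 -> w != 0 -> (size w <= 2)%N -> w.[x0] = 0 ->
  (forall x, - 2^-1 <= x <= 2^-1 -> 0 <= w.[x]) ->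
  \matrix_(i < n, j < n)
    transport_form c x0 (dg_basis R i) (dg_basis R j) \in unitmx.
Proof.
move=> n4 c0 w0 size_w wx0 w_ge0.
have size_b i : (i < n)%N -> size (dg_basis R i) = i.+1.
  by move=> i_n; rewrite size_dg_basis// -ltnS (leq_trans i_n).
apply: (gram_unitmx size_b (transport_form_linearl c x0)
  (transport_form_linearr c x0)) => p.
exact: (transport_form_nondegenerate c0 w0 size_w wx0 w_ge0).
Qed.

Lemma dg_transport_left_unitmx (R : realType) (n : nat) :
  (n <= 4)%N -> \matrix_(i < n, j < n)
    transport_form 1 2^-1 (dg_basis R i) (dg_basis R j) \in unitmx.
Proof.
have size_w : size ('X - (2^-1)%:P : {poly R}) = 2 by rewrite size_XsubC.
(* The weight 1/2 - x vanishes at the right end and is nonnegative on the cell. *)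
move=> n4; apply: (@dg_transport_unitmx R n _ _ (- ('X - (2^-1)%:P))) => //.
- by rewrite oppr_eq0 polyXsubC_eq0.
- by rewrite size_polyN size_w.
- by rewrite hornerN hornerXsubC subrr oppr0.
- by move=> x /andP[_ x_le]; rewrite hornerN hornerXsubC opprB subr_ge0.
Qed.

Lemma dg_transport_right_unitmx (R : realType) (n : nat) :
  (n <= 4)%N -> \matrix_(i < n, j < n)
    transport_form (-1) (- 2^-1) (dg_basis R i) (dg_basis R j) \in unitmx.
Proof.
(* Here the weight is x + 1/2, which vanishes at the left end. *)
move=> n4; apply: (@dg_transport_unitmx R n _ _ ('X - (- 2^-1)%:P)) => //.
- by rewrite polyXsubC_eq0.
- by rewrite size_XsubC.
- by rewrite hornerXsubC subrr.
- by move=> x /andP[x_ge _]; rewrite hornerXsubC subr_ge0.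
Qed.

(** * Rank of the evolution matrix *)

Definition comp_index (n : nat) (r : 'I_3) (j : 'I_n) : 'I_(n * 3) :=
  mxtens_index (j, r).

Lemma evolution_matrix_rank_le (R : realType) (K : nat) (dx dy kx ky : R) :
  (\rank (evolution_matrix K (lowMachDx R[i]) (lowMachDy R[i]) dx dy kx ky) <=
   K.+1 * K.+1 + K.+1 * K.+1)%N.
Proof.
have comp_notin (I : 'I_(K.+1 * K.+1 * 3)) :
    I \notin codom (comp_index comp_p) -> (mxtens_unindex I).2 != comp_p.
  apply: contra => /eqP I_p; apply/codomP; exists (mxtens_unindex I).1.
  by rewrite /comp_index -I_p -surjective_pairing mxtens_unindexK.
apply: (mxrank_support (f := comp_index comp_p) (g := comp_index comp_p)).
by move=> I J /comp_notin Ip /comp_notin Jp; rewrite mxE;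
  apply: evolution_block_velocity.
Qed.

(* Keeping the rows of u and p and the columns of p and u (in this order) gives
   a block lower triangular matrix, since the equation for u involves p only. *)
Lemma evolution_matrix_rank_pi (R : realType) (K : nat) (dx dy ky : R) :
  (K <= 3)%N -> 0 < dx ->
  \rank (evolution_matrix K (lowMachDx R[i]) (lowMachDy R[i]) dx dy (pi / dx) ky) =
  (K.+1 * K.+1 + K.+1 * K.+1)%N.
Proof.
move=> K3 dx0; apply/eqP; rewrite eqn_leq evolution_matrix_rank_le/=.
set E := evolution_matrix _ _ _ _ _ _ _.
have E_entry r s i j : E (comp_index r i) (comp_index s j) =
    evolution_block (lowMachDx R[i]) (lowMachDy R[i]) dx dy (pi / dx) ky
      (mxtens_unindex i).1 (mxtens_unindex i).2
      (mxtens_unindex j).1 (mxtens_unindex j).2 r s.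
  by rewrite [LHS]mxE /comp_index !mxtens_indexK.
pose sel (r s : 'I_3) (i : 'I_(K.+1 * K.+1 + K.+1 * K.+1)) :=
  match fintype.split i with
  | inl j => comp_index r j
  | inr j => comp_index s j
  end.
apply: leq_trans (mxrank_mxsub (sel comp_u comp_p) (sel comp_p comp_u) E).
pose sub r s := mxsub (comp_index r) (comp_index s) E.
have -> : mxsub (sel comp_u comp_p) (sel comp_p comp_u) E =
    block_mx (sub comp_u comp_p) 0 (sub comp_p comp_p) (sub comp_p comp_u).
  have splitl (j : 'I_(K.+1 * K.+1)) :
      fintype.split (lshift (K.+1 * K.+1) j) = inl j.
    exact: (unsplitK (inl j)).
  have splitr (j : 'I_(K.+1 * K.+1)) :
      fintype.split (rshift (K.+1 * K.+1) j) = inr j.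
    exact: (unsplitK (inr j)).
  rewrite -[LHS]submxK; congr block_mx; apply/matrixP => i j.
  - by rewrite [LHS]mxE [LHS]mxE [LHS]mxE [RHS]mxE /sel !splitl.
  - rewrite [LHS]mxE [LHS]mxE [LHS]mxE [RHS]mxE /sel splitl splitr.
    (* The upper right block couples u with u and so vanishes; the (p, p) block may be arbitrary. *)
    by rewrite E_entry evolution_block_velocity.
  - by rewrite [LHS]mxE [LHS]mxE [LHS]mxE [RHS]mxE /sel splitl splitr.
  - by rewrite [LHS]mxE [LHS]mxE [LHS]mxE [RHS]mxE /sel !splitr.
pose M := \matrix_(i < K.+1, j < K.+1) massM R i j.
pose A := \matrix_(i < K.+1, j < K.+1)
  transport_form 1 2^-1 (dg_basis R i) (dg_basis R j).
pose B := \matrix_(i < K.+1, j < K.+1)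
  transport_form (-1) (- 2^-1) (dg_basis R i) (dg_basis R j).
(* The first tensor factor acts on the x-degree and carries the transport, the second acts on the
   y-degree through the mass matrix. Both are real, so invertibility is inherited from [R]. *)
have tens_entry (T : 'M[R]_K.+1) (i j : 'I_(K.+1 * K.+1)) :
    map_mx (real_complex R) (dx^-1 *: (T *t M)) i j =
    (dx^-1 * (massM R (mxtens_unindex i).2 (mxtens_unindex j).2 *
      T (mxtens_unindex i).1 (mxtens_unindex j).1))%:C.
  by rewrite 4!mxE [massM _ _ _ * _]mulrC.
have -> : sub comp_u comp_p = map_mx (real_complex R) (dx^-1 *: (A *t M)).
  apply/matrixP => i j; rewrite tens_entry [LHS]mxE E_entry.
  by rewrite evolution_block_up// stiffG_form [A _ _]mxE.
have -> : sub comp_p comp_u = map_mx (real_complex R) (dx^-1 *: (B *t M)).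
  apply/matrixP => i j; rewrite tens_entry [LHS]mxE E_entry.
  by rewrite evolution_block_pu// stiffG_form [B _ _]mxE.
have dxU : dx^-1 \is a GRing.unit by rewrite unitfE invr_eq0 gt_eqF.
rewrite mxrank_unit// unitmxE det_lblock unitrM -!unitmxE !map_unitmx.
by rewrite !unitmxZ// !tensmx_unit// ?dg_mass_unitmx ?dg_transport_left_unitmx
  ?dg_transport_right_unitmx.
Qed.

(** * From the rank to the kernel dimension *)

Lemma dim_kerE (F : fieldType) (n : nat) (A : 'M[F]_n) :
  dim_ker A = (n - \rank A)%N.
Proof. by rewrite /dim_ker mxrank_ker mxrank_tr. Qed.

Unset Implicit Arguments.
Set Strict Implicit.

Theorem mainTheorem4 (R : realType) (K : nat) (hK : (K <= 3)%N)
    (dx dy : R) (hdx : 0 < dx) (hdy : 0 < dy) :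
  let E (kx ky : R) := evolution_matrix K (lowMachDx R[i]) (lowMachDy R[i])
                         dx dy kx ky in
  (exists kx ky : R, dim_ker (E kx ky) = (K.+1 ^ 2)%N) /\
  (forall kx ky : R, (K.+1 ^ 2 <= dim_ker (E kx ky))%N).
Proof.
move=> E; split; last first.
  move=> kx ky; rewrite dim_kerE -mulnn.
  (* The size is 3 (K+1)^2 and the rank at most 2 (K+1)^2. *)
  by have := evolution_matrix_rank_le K dx dy kx ky; rewrite -/(E kx ky); lia.
(* The choice of k_x gives t_x = -1; k_y is free and set to 0. *)
exists (pi / dx), 0; rewrite dim_kerE evolution_matrix_rank_pi// -mulnn; lia.
Qed.
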